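(* Let $n$ be a positive integer with $n>7$. Then $\mathfrak{pr}(K_n\odot K_1)= p_{n-1}$.
   Context: $p_i$ denotes the $i$-th prime number ($p_1=2$). $K_n$ is the complete graph on $n$ vertices. The corona $G\odot H$ of a graph $G$ with $|V(G)|=n$ and a graph $H$ is obtained from one copy of $G$ and $n$ copies of $H$ by joining the $i$-th vertex of $G$ to every vertex of the $i$-th copy of $H$. All graphs are finite and simple. A coprime labeling of a graph $G$ of order $N$ is an assignment of distinct labels from $\{1,\ldots,M\}$, for some integer $M\ge N$, to the vertices of $G$ such that adjacent vertices receive relatively prime labels. The minimum coprime number $\mathfrak{pr}(G)$ is the minimum value $M$ for which such a labeling exists. *)

(* Defs.v *)
From mathcomp Require Import all_boot.

Set Implicit Arguments.
Unset Strict Implicit.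
Unset Printing Implicit Defensive.

Lemma exists_prime_above m : exists p, (m < p) && prime p.
Proof. by have [p mp pp] := prime_above m; exists p; rewrite mp. Qed.

Definition next_prime m : nat := ex_minn (exists_prime_above m).

(* 1-indexed: p_1 = 2, p_2 = 3, ...; the value 0 at index 0 is a dummy. *)
Definition nth_prime i : nat := iter i next_prime 0.

Lemma next_primeP m : [/\ m < next_prime m, prime (next_prime m) &
  forall p, prime p -> m < p -> next_prime m <= p].
Proof.
rewrite /next_prime; case: ex_minnP => q /andP[mq pq] qmin.
by split=> // p pp mp; apply: qmin; rewrite mp.
Qed.

Lemma prime_nth_prime i : prime (nth_prime i.+1).
Proof. by have [] := next_primeP (nth_prime i). Qed.

Lemma ltn_nth_prime i j : (nth_prime i < nth_prime j) = (i < j).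
Proof.
apply: leqW_mono i j; apply: leq_mono; apply: homo_ltn; first exact: ltn_trans.
by move=> i; have [] := next_primeP (nth_prime i).
Qed.

Lemma nth_prime_inj : injective nth_prime.
Proof.
move=> i j e; have [lt_ij|lt_ji|//] := ltngtP i j.
  by move: lt_ij; rewrite -ltn_nth_prime e ltnn.
by move: lt_ji; rewrite -ltn_nth_prime e ltnn.
Qed.

Lemma nth_prime1 : nth_prime 1 = 2.
Proof.
have [lt0p pp minp] := next_primeP 0.
by apply/eqP; rewrite eqn_leq minp //= prime_gt1.
Qed.

Lemma nth_prime_onto p : prime p -> exists i, p = nth_prime i.+1.
Proof.
move=> pp; have exi : exists i, p <= nth_prime i.
  exists p; elim: p {pp} => // p IHp; apply: leq_ltn_trans IHp _.
  by rewrite ltn_nth_prime.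
case: (ex_minnP exi) => -[|i] le_p min_i; first by move: le_p (prime_gt0 pp); case: p {pp exi min_i}.
exists i; apply/eqP; rewrite eqn_leq le_p.
have [_ _ -> //] := next_primeP (nth_prime i).
by rewrite ltnNge; apply/negP => /min_i; rewrite ltnn.
Qed.

Record sgraph := SGraph {
  vertex :> finType;
  adj : rel vertex;
  adj_sym : symmetric adj;
  adj_irr : irreflexive adj }.

Section Complete.
Variable n : nat.

Definition complete_adj : rel 'I_n := fun u v => u != v.

Lemma complete_sym : symmetric complete_adj.
Proof. by move=> u v; rewrite /complete_adj eq_sym. Qed.

Lemma complete_irr : irreflexive complete_adj.
Proof. by move=> u; rewrite /complete_adj eqxx. Qed.

Definition complete_graph := SGraph complete_sym complete_irr.
End Complete.

Section Corona.
Variables G H : sgraph.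

(* [inl u] is the vertex u of G; [inr (u, x)] is the vertex x of the copy of H
   attached to u. *)
Definition corona_adj : rel (G + G * H)%type := fun a b =>
  match a, b with
  | inl u, inl v => adj u v
  | inl u, inr (v, _) => u == v
  | inr (u, _), inl v => u == v
  | inr (u, x), inr (v, y) => (u == v) && adj x y
  end.

Lemma corona_sym : symmetric corona_adj.
Proof.
by move=> [u|[u x]] [v|[v y]] /=; rewrite 1?[u == v]eq_sym // adj_sym.
Qed.

Lemma corona_irr : irreflexive corona_adj.
Proof. by move=> [u|[u x]] /=; rewrite ?eqxx adj_irr. Qed.

Definition corona := SGraph corona_sym corona_irr.
End Corona.

Section MinimumCoprimeNumber.
Variable G : sgraph.

(* A label is an element of 'I_M.+1 = {0, ..., M} that is required to be
   positive, i.e. an element of {1, ..., M}. *)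
Definition coprime_labeling M (f : {ffun G -> 'I_M.+1}) : bool :=
  [&& #|G| <= M, [forall u, 0 < f u], injectiveb f &
      [forall u, forall v, adj u v ==> coprime (f u) (f v)]].

Definition has_coprime_labeling M : bool :=
  [exists f : {ffun G -> 'I_M.+1}, coprime_labeling f].

Lemma exists_coprime_labeling : exists M, has_coprime_labeling M.
Proof.
pose M := nth_prime #|G|; exists M; apply/existsP.
pose f := [ffun u : G => inord (nth_prime (enum_rank u).+1) : 'I_M.+1].
have fE u : f u = nth_prime (enum_rank u).+1 :> nat.
  rewrite ffunE inordK // ltnS leqNgt ltn_nth_prime -leqNgt; exact: ltn_ord.
have f_inj : injective f.
  move=> u v /(congr1 val); rewrite /= !fE => e.
  by apply/enum_rank_inj/val_inj; case: (nth_prime_inj e).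
exists f; apply/and4P; split.
- rewrite /M; elim: #|G| => // k IHk; apply: leq_ltn_trans IHk _.
  by rewrite ltn_nth_prime.
- by apply/forallP => u; rewrite fE prime_gt0 ?prime_nth_prime.
- exact/injectiveP.
apply/forallP => u; apply/forallP => v; apply/implyP => uv.
rewrite !fE prime_coprime ?prime_nth_prime // dvdn_prime2 ?prime_nth_prime //.
rewrite -!fE; apply: contraTneq uv => /val_inj/f_inj ->.
by rewrite adj_irr.
Qed.

Definition min_coprime_number : nat := ex_minn exists_coprime_labeling.
End MinimumCoprimeNumber.

(* Main.v *)
Require Import Defs.
From mathcomp Require Import all_boot.

(** A pairwise coprime family contains the value 1 at most once, and the least
prime factors of its other members are distinct.  So [n] pairwise coprime
labels on the clique involve at least [n - 1] primes, and the largest label is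
at least the [(n-1)]-st prime ([coprime_family_lower_bound]).

The bound is attained by giving the clique the labels 1, 2, 3, 5, ..., up to
that prime.  The pendant neighbours then need distinct non-prime labels greater
than 1.  For a prime [p >= 5] the number [p - 1] works at once: it is coprime
to [p], it is even and larger than 2, hence composite, and distinct primes give
distinct values.  Only the clique labels 1, 2 and 3 remain, and their pendant
vertices receive 15, 9 and 8: these are composite, coprime to their neighbour
and not of the form [p - 1], since 16, 10 and 9 are not prime.  The label 15
fits below the bound as soon as the bound is at least [nth_prime 7 = 17], which
is what [n > 7] guarantees. *)

Lemma next_prime_eq m q :
  m < q -> prime q -> ~~ has prime (iota m.+1 (q - m.+1)) -> next_prime m = q.
Proof.
move=> mq pq no_prime; have [mp pp minp] := next_primeP m.
apply/eqP; rewrite eqn_leq minp //= leqNgt; apply: contra no_prime => lt_q.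
by apply/hasP; exists (next_prime m); rewrite // mem_iota subnKC // mp lt_q.
Qed.

Lemma nth_prime7 : nth_prime 7 = 17.
Proof.
rewrite /nth_prime /= (@next_prime_eq 0 2) // (@next_prime_eq 2 3) //.
rewrite (@next_prime_eq 3 5) // (@next_prime_eq 5 7) //.
by rewrite (@next_prime_eq 7 11) // (@next_prime_eq 11 13) //
  (@next_prime_eq 13 17).
Qed.

Lemma leq_nth_prime i j : (nth_prime i <= nth_prime j) = (i <= j).
Proof. by rewrite leqNgt ltn_nth_prime -leqNgt. Qed.

(** The sequence 1, 2, 3, 5, 7, ...: the dummy value of [nth_prime] at index 0
is replaced by 1, the only non-prime value that [pdiv] takes on positive
numbers. *)
Definition one_or_prime i := if i is 0 then 1 else nth_prime i.

Lemma one_or_primeP i : one_or_prime i = 1 \/ prime (one_or_prime i).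
Proof. by case: i => [|i]; [left | right; apply: prime_nth_prime]. Qed.

Lemma one_or_prime_gt0 i : 0 < one_or_prime i.
Proof. by have [->|/prime_gt0] := one_or_primeP i. Qed.

Lemma one_or_prime_inj : injective one_or_prime.
Proof.
move=> [|i] [|j] // e; last exact: nth_prime_inj.
- by have := prime_nth_prime j; rewrite -[nth_prime _]e.
- by have := prime_nth_prime i; rewrite [nth_prime _]e.
Qed.

Lemma coprime_one_or_prime i j :
  i != j -> coprime (one_or_prime i) (one_or_prime j).
Proof.
move=> ij; have [->|pi] := one_or_primeP i; first exact: coprime1n.
have [->|pj] := one_or_primeP j; first exact: coprimen1.
by rewrite prime_coprime // dvdn_prime2 // (inj_eq one_or_prime_inj).
Qed.

(** Pigeonhole: if the bound failed, sending each member to the index of its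
least prime factor would inject ['I_n] into ['I_n.-1]. *)
Lemma coprime_family_lower_bound n (f : 'I_n -> nat) M :
    injective f -> (forall u, 0 < f u <= M) ->
    (forall u v, u != v -> coprime (f u) (f v)) ->
  nth_prime n.-1 <= M.
Proof.
case: n f => [|n] f f_inj f_bnd f_cop //=.
rewrite leqNgt; apply/negP => ltM.
have n_gt0 : 0 < n by case: n {f f_inj f_bnd f_cop} ltM.
have /fin_all_exists[g gP] u : exists j : 'I_n, pdiv (f u) = one_or_prime j.
  have /andP[fu0 fuM] := f_bnd u.
  have [fu1|fu_neq1] := eqVneq (f u) 1; first by exists (Ordinal n_gt0); rewrite fu1.
  have fu_gt1 : 1 < f u by rewrite ltn_neqAle eq_sym fu_neq1.
  have [i pE] := nth_prime_onto (pdiv_prime fu_gt1).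
  have lt_in : i.+1 < n.
    by rewrite -ltn_nth_prime -pE (leq_ltn_trans _ ltM) // (leq_trans _ fuM) ?pdiv_leq.
  by exists (Ordinal lt_in).
have g_inj : injective g.
  move=> u v guv; apply/eqP/negPn/negP => uv.
  have eq_pdiv : pdiv (f u) = pdiv (f v) by rewrite !gP guv.
  (* A common least prime factor of coprime numbers can only be the
     conventional value [pdiv 1 = 1], so both members would be 1. *)
  have pdiv1 : pdiv (f u) = 1.
    apply/eqP; rewrite -dvdn1 -(eqP (f_cop _ _ uv)) dvdn_gcd pdiv_dvd.
    by rewrite eq_pdiv pdiv_dvd.
  have pdiv_eq1 w : pdiv (f w) = 1 -> f w = 1.
    move=> e; have /andP[fw0 _] := f_bnd w; apply/eqP; rewrite eqn_leq fw0 andbT.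
    by rewrite leqNgt; apply/negP => /pdiv_prime; rewrite e.
  case/negP: uv; apply/eqP/f_inj.
  by rewrite (pdiv_eq1 u pdiv1) (pdiv_eq1 v) // -eq_pdiv.
by have := leq_card g g_inj; rewrite !card_ord ltnn.
Qed.

(** The argument is the label of the clique vertex adjacent to the pendant
vertex.  The values 15, 9 and 8 are composite and not one less than a prime, so
that they clash neither with clique labels nor with the other pendant labels. *)
Definition pendant_label p :=
  match p with 1 => 15 | 2 => 9 | 3 => 8 | _ => p.-1 end.

Variant pendant_label_spec p : nat -> Prop :=
  | PendantOne of p = 1 : pendant_label_spec p 15
  | PendantTwo of p = 2 : pendant_label_spec p 9
  | PendantThree of p = 3 : pendant_label_spec p 8
  | PendantPred of prime p & 3 < p & odd p : pendant_label_spec p p.-1.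

Lemma pendant_labelP i :
  pendant_label_spec (one_or_prime i) (pendant_label (one_or_prime i)).
Proof.
have [->|pp] := one_or_primeP i; first exact: PendantOne.
case: (one_or_prime i) pp => [|[|[|[|p]]]] // pp.
- exact: PendantTwo.
- exact: PendantThree.
by apply: PendantPred => //; have [] := even_prime pp.
Qed.

Lemma coprime_pendant_label i :
  coprime (one_or_prime i) (pendant_label (one_or_prime i)).
Proof.
have p_gt0 := one_or_prime_gt0 i.
by case: pendant_labelP => [->|->|->|_ _ _] //; apply: coprimenP.
Qed.

(** Pendant labels are composite: [p.-1] is even, and [3 < p] makes it larger
than 2. *)
Lemma one_or_prime_neq_pendant i j :
  one_or_prime i != pendant_label (one_or_prime j).
Proof.
suff [l1 lN] : 1 < pendant_label (one_or_prime j) /\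
               ~~ prime (pendant_label (one_or_prime j)).
  apply/eqP => e; move: l1 lN; rewrite -e.
  by have [->|->] := one_or_primeP i.
case: pendant_labelP => [_|_|_|_ p_gt3 p_odd] //.
case: (one_or_prime j) p_gt3 p_odd => // p; rewrite /= ltnS => p_gt2 p_even.
split; first exact: ltnW.
by apply/negP => /even_prime[p2|]; [rewrite p2 in p_gt2 | apply/negP].
Qed.

Lemma pendant_label_inj i j :
  pendant_label (one_or_prime i) = pendant_label (one_or_prime j) -> i = j.
Proof.
move=> e; apply: one_or_prime_inj; move: e.
have predK p c : prime p -> p.-1 = c -> p = c.+1.
  by move=> /prime_gt0/prednK <- /= ->.
case: pendant_labelP => [->|->|->|pi _ _];
  case: pendant_labelP => [->|->|->|pj _ _] // e.
(* The mixed cases would make 16, 10 or 9 a prime. *)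
all: try by have pE := predK _ _ pj (esym e); rewrite pE in pj.
all: try by have pE := predK _ _ pi e; rewrite pE in pi.
by rewrite (predK _ _ pi e) prednK // prime_gt0.
Qed.

Lemma one_or_prime_le n i : i < n -> 1 < n -> one_or_prime i <= nth_prime n.-1.
Proof.
case: n i => [|[|n]] // [|i] // lt_in _.
  exact/prime_gt0/prime_nth_prime.
by rewrite -[one_or_prime _]/(nth_prime i.+1) leq_nth_prime.
Qed.

Lemma pendant_label_bounds n i :
    i < n -> 7 < n ->
  0 < pendant_label (one_or_prime i) <= nth_prime n.-1.
Proof.
move=> lt_in n_gt7.
have ge17 : 17 <= nth_prime n.-1.
  by rewrite -nth_prime7 leq_nth_prime; case: n n_gt7 {lt_in}.
have := one_or_prime_le _ _ lt_in (leq_trans _ n_gt7) => /(_ isT).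
case: pendant_labelP => [_ _|_ _|_ _|_ p_gt3 _ le_p];
  try by rewrite (leq_trans _ ge17).
by rewrite (leq_trans (leq_pred _) le_p) andbT; case: (one_or_prime i) p_gt3 => [|[]].
Qed.

Section CoronaLabeling.
Variable n : nat.
Let G := corona (complete_graph n) (complete_graph 1).

Definition corona_label (a : G) : nat :=
  match a with
  | inl u => one_or_prime (u : 'I_n)
  | inr (u, _) => pendant_label (one_or_prime (u : 'I_n))
  end.

Lemma corona_label_inj : injective corona_label.
Proof.
move=> [u|[u x]] [v|[v y]] /= e.
- by rewrite (val_inj (one_or_prime_inj _ _ e)).
- by have := one_or_prime_neq_pendant u v; rewrite e eqxx.
- by have := one_or_prime_neq_pendant v u; rewrite e eqxx.
rewrite (val_inj (pendant_label_inj _ _ e)); congr (inr (_, _)).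
by apply/val_inj; case: x y {e} => [[|x] ?] [[|y] ?].
Qed.

Lemma coprime_corona_label a b :
  adj a b -> coprime (corona_label a) (corona_label b).
Proof.
case: a b => [u|[u x]] [v|[v y]] /=.
- exact: coprime_one_or_prime.
- by move/eqP->; apply: coprime_pendant_label.
- by move/eqP->; rewrite coprime_sym; apply: coprime_pendant_label.
by case: x y => [[|x] ?] [[|y] ?] //; rewrite andbF.
Qed.

Lemma corona_label_bounds a :
  7 < n -> 0 < corona_label a <= nth_prime n.-1.
Proof.
move=> n_gt7; case: a => [u|[u x]] /=; last exact: pendant_label_bounds.
by rewrite one_or_prime_gt0 one_or_prime_le // (leq_trans _ n_gt7).
Qed.
End CoronaLabeling.

(** The inequality [#|G| <= M] follows from the injection of the vertices into
the [M] positive labels. *)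
Lemma has_coprime_labelingI (G : sgraph) M (l : G -> nat) :
    injective l -> (forall a, 0 < l a <= M) ->
    (forall a b, adj a b -> coprime (l a) (l b)) ->
  has_coprime_labeling G M.
Proof.
move=> l_inj l_bnd l_cop.
pose f := [ffun a : G => inord (l a) : 'I_M.+1].
have fE a : f a = l a :> nat.
  by rewrite ffunE inordK // ltnS; case/andP: (l_bnd a).
have f_inj : injective f by move=> a b /(congr1 val); rewrite /= !fE => /l_inj.
have f_gt0 a : 0 < f a by rewrite fE; case/andP: (l_bnd a).
apply/existsP; exists f; apply/and4P; split; last 1 first.
- by do 2![apply/forallP => ?]; apply/implyP; rewrite !fE; apply: l_cop.
- have := cardsC1 (ord0 : 'I_M.+1); rewrite card_ord /= => <-.
  rewrite -cardsT -(card_imset _ f_inj) subset_leq_card //.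
  apply/subsetP => _ /imsetP[a _ ->]; rewrite !inE.
  by apply: contraTneq (f_gt0 a) => ->.
- exact/forallP.
exact/injectiveP.
Qed.

Theorem theorem7 (n : nat) (hn : 7 < n) :
  min_coprime_number (corona (complete_graph n) (complete_graph 1)) =
  nth_prime n.-1.
Proof.
rewrite /min_coprime_number; case: ex_minnP => M labM minM.
apply/eqP; rewrite eqn_leq minM /=; last first.
  apply: (has_coprime_labelingI _ _ (@corona_label n)).
  - exact: corona_label_inj.
  - by move=> a; apply: corona_label_bounds.
  exact: coprime_corona_label.
have /existsP[f /and4P[_ /forallP f_gt0 /injectiveP f_inj /forallP f_cop]] := labM.
apply: (@coprime_family_lower_bound n (fun u => f (inl u))).
- by move=> u v /val_inj/f_inj[].
- by move=> u; rewrite f_gt0 -ltnS ltn_ord.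
by move=> u v uv; have /forallP/(_ (inl v))/implyP := f_cop (inl u); apply.
Qed.
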